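(* Let $B=\mathbb{C}\oplus\mathbb{C}$ be the $\mathbb{Z}_2$-graded Hilbert space with $B_0=\mathrm{span}\{\ket{0}\}$ and $B_1=\mathrm{span}\{\ket{1}\}$, and let $\mathbf{LFM}$ be the monoidal category whose objects are the tensor powers $B^{\otimes n}$, $n\in\mathbb{N}$, and whose morphisms are the pure maps between them. Let $T$ be the monoidal signature with operations $\mathsf{swap}:2\to 2$, $\mathsf{dual}:0\to 2$, $\mathsf{dual}^\dagger:2\to 0$, $\mathsf{fswap}:2\to 2$, $\mathsf{black}_2:0\to 2$, $\mathsf{black}_3:0\to 3$, and $\mathsf{white}_z:0\to 2$ for every $z\in\mathbb{C}$, let $F[T]$ be the free PRO on $T$, and let $f:F[T]\to\mathbf{LFM}$ be the strict monoidal functor sending the object $n$ to $B^{\otimes n}$ and the generators to the linear maps $\mathsf{swap}\mapsto(\ket{b_1b_2}\mapsto\ket{b_2b_1})$; $\mathsf{dual}\mapsto(1\mapsto\ket{00}+\ket{11})$; $\mathsf{dual}^\dagger\mapsto(\ket{b_1b_2}\mapsto 1$ if $b_1=b_2$, $0$ otherwise$)$; $\mathsf{fswap}\mapsto(\ket{00}\mapsto\ket{00},\ \ket{10}\mapsto\ket{01},\ \ket{01}\mapsto\ket{10},\ \ket{11}\mapsto-\ket{11})$; $\mathsf{black}_2\mapsto(1\mapsto\ket{10}+\ket{01})$; $\mathsf{black}_3\mapsto(1\mapsto\ket{100}+\ket{010}+\ket{001})$; $\mathsf{white}_z\mapsto(1\mapsto\ket{00}+z\ket{11})$. Then $f$ is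 full: for all $n,m\in\mathbb{N}$, every morphism $B^{\otimes n}\to B^{\otimes m}$ of $\mathbf{LFM}$ is equal to $f(d)$ for some morphism $d:n\to m$ of $F[T]$.
   Context: A $\mathbb{Z}_2$-graded Hilbert space is a complex Hilbert space $H$ with a decomposition $H=H_0\oplus H_1$. A pure map $g:H\to K$ between $\mathbb{Z}_2$-graded Hilbert spaces is a bounded linear map which is either even ($g(H_0)\subseteq K_0$ and $g(H_1)\subseteq K_1$) or odd ($g(H_0)\subseteq K_1$ and $g(H_1)\subseteq K_0$). The tensor product is graded by $(H\otimes K)_0=(H_0\otimes K_0)\oplus(H_1\otimes K_1)$ and $(H\otimes K)_1=(H_0\otimes K_1)\oplus(H_1\otimes K_0)$, with unit $\mathbb{C}\oplus 0$; tensor products of pure maps are pure. We write $\ket{b_1\ldots b_n}=\ket{b_1}\otimes\cdots\otimes\ket{b_n}$ for $b_i\in\{0,1\}$. A PRO is a strict monoidal category whose objects are the natural numbers with monoidal product given on objects by addition; for a monoidal signature (a set of operations $g_i:n_i\to m_i$), the free PRO $F[T]$ has as morphisms the formal sequential and parallel composites of the operations, modulo the axioms of strict monoidal categories (equivalently, string diagrams up to planar isotopy). Here $B^{\otimes 0}=\mathbb{C}$ and a map $\mathbb{C}\to B^{\otimes n}$ is specified by the image of $1$. *)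

(* Defs.v *)
From HB Require Import structures.
From mathcomp Require Import all_boot all_order all_algebra.
From mathcomp Require Import reals complex.
Set Implicit Arguments. Unset Strict Implicit. Unset Printing Implicit Defensive.
Import Order.TTheory GRing.Theory Num.Theory.
Local Open Scope ring_scope.

Section LFM.
Variable R : realType.
Local Notation C := R[i].

(* A linear map B^{(x)n} -> B^{(x)m} is given by its matrix in the
   computational basis |b_1 ... b_k>, basis vectors being bit lists:
   M o i = coefficient of |o> in the image of |i>.  Only entries with
   size o = m and size i = n are meaningful. *)
Definition lmap := seq bool -> seq bool -> C.

Definition parity (s : seq bool) : bool := odd (count id s).

Definition even_map n m (g : lmap) : Prop :=
  forall (o : m.-tuple bool) (i : n.-tuple bool),
    g o i != 0 -> parity o = parity i.
Definition odd_map n m (g : lmap) : Prop :=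
  forall (o : m.-tuple bool) (i : n.-tuple bool),
    g o i != 0 -> parity o != parity i.
Definition pure_map n m (g : lmap) : Prop := even_map n m g \/ odd_map n m g.

Inductive gen : nat -> nat -> Type :=
| g_swap : gen 2 2
| g_dual : gen 0 2
| g_dualdag : gen 2 0
| g_fswap : gen 2 2
| g_black2 : gen 0 2
| g_black3 : gen 0 3
| g_white : C -> gen 0 2.

(* Terms of the free PRO F[T] (morphisms are these terms modulo the
   strict monoidal axioms; fullness only concerns existence of a term). *)
Inductive diag : nat -> nat -> Type :=
| d_gen n m : gen n m -> diag n m
| d_id n : diag n n
| d_comp n k m : diag n k -> diag k m -> diag n m
| d_tens n1 m1 n2 m2 : diag n1 m1 -> diag n2 m2 -> diag (n1 + n2) (m1 + m2).

Definition bv (b : bool) : C := if b then 1 else 0.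

Definition interp_gen n m (g : gen n m) : lmap :=
  match g with
  | g_swap => fun o i => bv (o == rev i)
  | g_dual => fun o i => bv (o == [:: false; false]) + bv (o == [:: true; true])
  | g_dualdag => fun o i => bv (i == [:: false; false]) + bv (i == [:: true; true])
  | g_fswap => fun o i =>
      if i == [:: true; true] then - bv (o == i) else bv (o == rev i)
  | g_black2 => fun o i => bv (o == [:: true; false]) + bv (o == [:: false; true])
  | g_black3 => fun o i =>
      bv (o == [:: true; false; false]) + bv (o == [:: false; true; false])
      + bv (o == [:: false; false; true])
  | g_white z => fun o i => bv (o == [:: false; false]) + z * bv (o == [:: true; true])
  end.

Fixpoint interp n m (d : diag n m) : lmap :=
  match d with
  | d_gen _ _ g => interp_gen g
  | d_id _ => fun o i => bv (o == i)
  | d_comp _ k _ d1 d2 => fun o i =>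
      \sum_(t : k.-tuple bool) interp d2 o t * interp d1 t i
  | d_tens n1 m1 _ _ d1 d2 => fun o i =>
      interp d1 (take m1 o) (take n1 i) * interp d2 (drop m1 o) (drop n1 i)
  end.
End LFM.

(* Main.v *)
(* Bending input wires with dual and its adjoint reduces everything to states.
   For an odd state psi consider the map D_psi : 1 -> n with |0> |-> |0...0> and
   |1> |-> psi.  Splitting the control wire with a W state, applying
   D_psi (x) D_phi and merging the outputs wire by wire (|00> |-> |0>,
   |01>, |10> |-> |1>, |11> |-> 0) gives D_(psi + phi), because only one of the
   two branches leaves the vacuum.  So it is enough to obtain D for odd basis
   states, which follows from the copy map |b> |-> |bbb>.  Even states are
   obtained from odd ones by flipping a wire. *)
Require Import Defs.
From mathcomp Require Import all_boot all_order all_algebra.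
From mathcomp Require Import reals complex.
From mathcomp Require Import ring.
Local Open Scope ring_scope.
Import GRing.Theory.

Section Realizable.
Set Implicit Arguments.
Unset Strict Implicit.
Variable R : realType.
Local Notation C := R[i].
Local Notation bv := (bv R).
Local Notation lmap := (lmap R).

(** * Sums over bit strings *)

(** The recursive form unfolds by [/=] for a concrete number of wires and keeps the indices plain
    lists instead of tuples. *)
Fixpoint bsum n (F : seq bool -> C) : C :=
  if n is n'.+1 then
    bsum n' (fun t => F (false :: t)) + bsum n' (fun t => F (true :: t))
  else F [::].

Lemma bvM b c : bv (b && c) = bv b * bv c.
Proof. by case: b; rewrite ?mul1r ?mul0r. Qed.

Lemma bsumE n (F : seq bool -> C) : \sum_(t : n.-tuple bool) F t = bsum n F.
Proof.
elim: n F => [|n IHn] F /=.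
  by rewrite (bigD1 [tuple]) //= big1 ?addr0 // => t; rewrite (tuple0 t).
rewrite -!IHn (reindex (fun p : bool * n.-tuple bool => [tuple of p.1 :: p.2])).
  rewrite -(pair_bigA _ (fun b (t : n.-tuple bool) => F (b :: t))) /=.
  by rewrite big_bool addrC.
exists (fun t => (thead t, [tuple of behead t])) => [[b t] _|t _] /=.
  by congr pair; apply: val_inj.
by case/tupleP: t => b t; apply: val_inj.
Qed.

Lemma eq_bsum n (F G : seq bool -> C) :
  (forall t, size t = n -> F t = G t) -> bsum n F = bsum n G.
Proof.
elim: n F G => [|n IHn] F G E /=; first exact: E.
by congr (_ + _); apply: IHn => t st; apply: E; rewrite /= st.
Qed.

Lemma bsum0 n : bsum n (fun=> 0) = 0.
Proof. by elim: n => //= n ->; rewrite addr0. Qed.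

Lemma bsumD n F G : bsum n (fun t => F t + G t) = bsum n F + bsum n G.
Proof. by elim: n F G => //= n IHn F G; rewrite !IHn addrACA. Qed.

Lemma bsumZ n c F : bsum n (fun t => c * F t) = c * bsum n F.
Proof. by elim: n F => //= n IHn F; rewrite !IHn mulrDr. Qed.

Lemma bsum_cat n m F :
  bsum (n + m) F = bsum n (fun s => bsum m (fun t => F (s ++ t))).
Proof. by elim: n F => //= n IHn F; rewrite !IHn. Qed.

Lemma bsum_delta n F s : size s = n -> bsum n (fun t => bv (t == s) * F t) = F s.
Proof.
elim: n F s => [|n IHn] F [|b s] //= => [_|[sz]]; first by rewrite mul1r.
have Z G : bsum n (fun t => bv false * G t) = 0.
  by rewrite -[RHS](bsum0 n); apply: eq_bsum => t _; rewrite mul0r.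
case: b.
  by rewrite (Z (fun t => F (false :: t))) add0r (IHn (fun t => F (true :: t))).
by rewrite (Z (fun t => F (true :: t))) addr0 (IHn (fun t => F (false :: t))).
Qed.

(** * Realizable matrices and their closure properties *)

Definition realizable n m (g : lmap) : Prop :=
  exists d : diag R n m, forall o i : seq bool,
    size o = m -> size i = n -> g o i = interp d o i.

Lemma realizable_ext n m (g h : lmap) :
  realizable n m g ->
  (forall o i, size o = m -> size i = n -> h o i = g o i) -> realizable n m h.
Proof. by move=> [d Hd] E; exists d => o i so si; rewrite E // Hd. Qed.

Lemma realizable_gen n m (x : gen R n m) : realizable n m (interp_gen x).
Proof. by exists (d_gen x). Qed.

Lemma realizable_id n : realizable n n (fun o i => bv (o == i)).
Proof. by exists (d_id R n). Qed.

Lemma realizable_comp n k m (g h : lmap) :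
  realizable n k g -> realizable k m h ->
  realizable n m (fun o i => bsum k (fun t => h o t * g t i)).
Proof.
move=> [d Hd] [e He]; exists (d_comp d e) => o i so si /=.
rewrite (bsumE _ (fun t => interp e o t * interp d t i)).
by apply: eq_bsum => t st; rewrite Hd ?He.
Qed.

Lemma realizable_tens n1 m1 n2 m2 (g h : lmap) :
  realizable n1 m1 g -> realizable n2 m2 h ->
  realizable (n1 + n2) (m1 + m2) (fun o i =>
    g (take m1 o) (take n1 i) * h (drop m1 o) (drop n1 i)).
Proof.
move=> [d Hd] [e He]; exists (d_tens d e) => o i so si /=.
by rewrite Hd ?He // ?size_drop ?size_takel ?so ?si ?leq_addr // addKn.
Qed.

Lemma realizable_precomp_weighted n' n m (c : seq bool -> C) (f : seq bool -> seq bool) g :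
  (forall i, size i = n' -> size (f i) = n) ->
  realizable n' n (fun o i => c i * bv (o == f i)) -> realizable n m g ->
  realizable n' m (fun o i => c i * g o (f i)).
Proof.
move=> sf rf rg; apply: realizable_ext (realizable_comp rf rg) _.
move=> o i so si; rewrite -(bsum_delta _ (sf i si)) -bsumZ.
by apply: eq_bsum => t _; rewrite [in RHS]mulrC mulrA.
Qed.

Lemma realizable_precomp n' n m (f : seq bool -> seq bool) g :
  (forall i, size i = n' -> size (f i) = n) ->
  realizable n' n (fun o i => bv (o == f i)) -> realizable n m g ->
  realizable n' m (fun o i => g o (f i)).
Proof.
move=> sf rf rg; apply: realizable_ext (realizable_comp rf rg) _.
move=> o i so si; rewrite -(bsum_delta _ (sf i si)).
by apply: eq_bsum => t _; rewrite mulrC.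
Qed.

(** Here [f] runs from outputs back to inputs: the matrix composed with [g] is the transpose of the
    one for |o> to |f o>. *)
Lemma realizable_postcomp n m m' (f : seq bool -> seq bool) g :
  (forall o, size o = m' -> size (f o) = m) ->
  realizable m m' (fun o i => bv (i == f o)) -> realizable n m g ->
  realizable n m' (fun o i => g (f o) i).
Proof.
move=> sf rf rg; apply: realizable_ext (realizable_comp rg rf) _.
by move=> o i so si; rewrite -(bsum_delta (g^~ i) (sf o so)).
Qed.

(** The cap [dualdag] joins the new input to the first output of [g]; repeated bending thus turns
    states into maps. *)
Lemma realizable_bend n m g : realizable n m.+1 g ->
  realizable n.+1 m (fun o i => g (head false i :: o) (behead i)).
Proof.
move=> rg; have r1 := realizable_tens (realizable_id 1) rg.
have r2 := realizable_tens (realizable_gen (g_dualdag R)) (realizable_id m).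
apply: realizable_ext (realizable_comp r1 r2) _ => o [|a i] //= so [si].
rewrite -(bsum_delta (fun t => g (a :: t) i) so) -!bsumD.
apply: eq_bsum => t _; rewrite /= !drop0 !take0 (eq_sym o).
by case: a => /=; ring.
Qed.

(** Capping [white] with parameter z gives the scalar 1 + z, hence the parameter [c - 1]. *)
Lemma realizable_scale n m c g :
  realizable n m g -> realizable n m (fun o i => c * g o i).
Proof.
move=> rg; have rc := realizable_comp (realizable_gen (g_white (c - 1)))
  (realizable_gen (g_dualdag R)).
apply: realizable_ext (realizable_tens rc rg) _ => o i _ _.
by rewrite /= !drop0; ring.
Qed.

(** * Elementary maps built from the generators *)

Lemma realizable_flip : realizable 1 1 (fun o i => bv (o == map negb i)).
Proof.
apply: realizable_ext (realizable_bend (realizable_gen (g_black2 R))) _.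
by case=> [|[] [|? ?]] // [|[] [|? ?]] //= _ _; ring.
Qed.

Lemma realizable_swap :
  realizable 2 2 (fun o i => bv (o == rev i)).
Proof. exact: realizable_gen (g_swap R). Qed.

Lemma realizable_phase z :
  realizable 1 1 (fun o i => (if head false i then z else 1) * bv (o == i)).
Proof.
apply: realizable_ext (realizable_bend (realizable_gen (g_white z))) _.
by case=> [|[] [|? ?]] // [|[] [|? ?]] //= _ _; ring.
Qed.

(** Capping the first two legs of [black3] leaves only its term |001>. *)
Lemma realizable_ket1 : realizable 0 1 (fun o _ => bv (o == [:: true])).
Proof.
apply: realizable_ext (realizable_comp (realizable_gen (g_black3 R))
  (realizable_tens (realizable_gen (g_dualdag R)) (realizable_id 1))) _.
by case=> [|[] [|? ?]] // [] //= _ _; ring.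
Qed.

Lemma realizable_ket b : realizable 0 1 (fun o _ => bv (o == [:: b])).
Proof.
case: b; first exact: realizable_ket1.
apply: realizable_ext (realizable_comp realizable_ket1 realizable_flip) _.
by case=> [|[] [|? ?]] // [] //= _ _; ring.
Qed.

Lemma realizable_bra b : realizable 1 0 (fun _ i => bv (i == [:: b])).
Proof.
apply: realizable_ext (realizable_bend (realizable_ket b)) _.
by case=> // -[|c [|? ?]].
Qed.

(** The bent [black3] sends |0> to |10> + |01> and |1> to |00>; a flip in front makes it conserve
    the number of ones. *)
Lemma realizable_split : realizable 1 2 (fun o i =>
  bv (count id o == count id i)).
Proof.
have r := realizable_bend (realizable_gen (g_black3 R)).
apply: realizable_ext (realizable_comp realizable_flip r) _.
by case=> [|[] [|[] [|? ?]]] // [|[] [|? ?]] //= _ _; ring.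
Qed.

(** Two bends and a final flip of [black3]. A single output cannot hold two ones, so |11> is sent to
    0. *)
Lemma realizable_merge : realizable 2 1 (fun o i =>
  bv (count id o == count id i)).
Proof.
have r := realizable_bend (realizable_bend (realizable_gen (g_black3 R))).
apply: realizable_ext (realizable_comp r realizable_flip) _.
by case=> [|[] [|? ?]] // [|[] [|[] [|? ?]]] //= _ _; ring.
Qed.

Lemma realizable_cz : realizable 2 2 (fun o i =>
  (if all id i then -1 else 1) * bv (o == i)).
Proof.
apply: realizable_ext (realizable_comp (realizable_gen (g_fswap R))
  realizable_swap) _.
by case=> [|[] [|[] [|? ?]]] // [|[] [|[] [|? ?]]] //= _ _; rewrite /rev /=; ring.
Qed.

(* swap o fswap is the controlled Z.  Linking the wires w and u by a loop that
   crosses each of them once gives sum_a (-1)^(a (w + u)), that is, twice the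
   projector onto w = u. *)
Lemma realizable_copy : realizable 1 3 (fun o i =>
  bv (o == nseq 3 (head false i))).
Proof.
have cup := realizable_gen (g_dual R).
(* The five wires are w, the two halves a, a' of the loop, and u, v. The second cup forces u = v,
   which supplies the third copy; [r3] closes the loop. *)
have r1 := realizable_tens (realizable_id 1) (realizable_tens cup cup).
have r2 := realizable_tens (realizable_tens realizable_cz realizable_cz)
  (realizable_id 1).
have r3 := realizable_tens (realizable_id 1)
  (realizable_tens (realizable_gen (g_dualdag R)) (realizable_id 2)).
have r32 : realizable 5 3 (fun o i =>
   (if all id (take 2 i) then -1 else 1) *
   (if all id (take 2 (drop 2 i)) then -1 else 1) *
   ((nth false i 1 == nth false i 2)%:R *
    bv (o == [:: nth false i 0, nth false i 3 & drop 4 i]))).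
  apply: realizable_ext (realizable_precomp_weighted (f := id) (c := fun i =>
    (if all id (take 2 i) then -1 else 1) *
    (if all id (take 2 (drop 2 i)) then -1 else 1)) _ _ r3) _ => //.
    apply: realizable_ext r2 _.
    case=> [|? [|? [|? [|? [|? [|? ?]]]]]] //.
    case=> [|? [|? [|? [|? [|? [|? ?]]]]]] // _ _.
    by rewrite /= !eqseq_cons !bvM !andbT; ring.
  case=> [|x [|y [|z [|? ?]]]] // [|b [|a [|a' [|u [|v [|? ?]]]]]] // _ _ /=.
  rewrite !eqseq_cons !andbT !bvM.
  by case: a; case: a' => /=; ring.
apply: realizable_ext (realizable_scale 2^-1 (realizable_comp r1 r32)) _.
by case=> [|[] [|[] [|[] [|? ?]]]] // [|[] [|? ?]] //= _ _; field.
Qed.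

(** * Wire permutations and wirewise merging *)

Lemma realizable_tens_fun n m (f h : seq bool -> seq bool) :
  (forall i, size i = n -> size (f i) = n) ->
  realizable n n (fun o i => bv (o == f i)) ->
  realizable m m (fun o i => bv (o == h i)) ->
  realizable (n + m) (n + m)
    (fun o i => bv (o == f (take n i) ++ h (drop n i))).
Proof.
move=> sf rf rh; apply: realizable_ext (realizable_tens rf rh) _.
move=> o i so si; rewrite -bvM -{1}(cat_take_drop n o) eqseq_cat //.
by rewrite sf ?size_takel ?so ?si ?leq_addr.
Qed.

(** Swapping the first two wires and then rotating all but the first carries the original first wire
    to the end. *)
Lemma realizable_rot1 n : realizable n n (fun o i => bv (o == rot 1 i)).
Proof.
elim: n => [|n IHn].
  by apply: realizable_ext (realizable_id 0) _ => o [].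
case: n IHn => [_|n IHn].
  by apply: realizable_ext (realizable_id 1) _ => o [|a []].
have r1 := realizable_tens_fun (fun i => id) (realizable_id 1) IHn.
have r2 := realizable_tens_fun (fun i si => etrans (size_rev i) si)
  realizable_swap (realizable_id n).
apply: realizable_ext (realizable_precomp _ r2 r1) _.
  by move=> i si; rewrite size_cat size_rev -size_cat cat_take_drop.
move=> o [|a [|b i]] // _ _; have E : rev [:: a; b] = [:: b; a] by [].
by rewrite /= !drop0 take0 E /rot /= !drop0 take0.
Qed.

Lemma realizable_rot n k : realizable n n (fun o i => bv (o == rot k i)).
Proof.
elim: k => [|k IHk].
  by apply: realizable_ext (realizable_id n) _ => o i; rewrite rot0.
have [lenk|ltkn] := leqP n k.
  by apply: realizable_ext IHk _ => o i _ si; rewrite !rot_oversize ?si // ltnW.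
apply: realizable_ext (realizable_precomp _ IHk (realizable_rot1 n)) _.
  by move=> i; rewrite size_rot.
by move=> o i so si; rewrite -rotS ?si.
Qed.

(** The sums are taken in [nat]: two ones on the same wire give 2, which is no bit, so the amplitude
    vanishes as it does for a single merge. *)
Lemma realizable_merge_wires n : realizable (n + n) n (fun o i =>
  bv (map nat_of_bool o ==
      [seq (p.1 + p.2)%N | p : bool * bool <- zip (take n i) (drop n i)])).
Proof.
elim: n => [|n IHn].
  by apply: realizable_ext (realizable_id 0) _ => -[] // [].
(* Rotating the n+1 wires after the first one brings the head of the second block next to the head
   of the first block. *)
have rot_n := realizable_tens_fun (fun i si => etrans (size_rot n i) si)
  (realizable_rot n.+1 n) (realizable_id n).
have rf := realizable_tens_fun (fun i => id) (realizable_id 1) rot_n.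
have -> : (n.+1 + n.+1 = 1 + (n.+1 + n))%N by rewrite addnS.
apply: realizable_ext (realizable_precomp _ rf
  (realizable_tens realizable_merge IHn)) _.
  move=> i si; rewrite size_cat (size_cat (rot _ _)) size_rot -!size_cat.
  by rewrite !cat_take_drop si addSn.
move=> [|x o] // i [so] si.
have [a [i1 [b [i2 [-> s1 s2]]]]] : exists a i1 b i2,
    [/\ i = a :: i1 ++ b :: i2, size i1 = n & size i2 = n].
  case: i si => // a i [/= si].
  have {}si : size i = (n + n.+1)%N by rewrite addnS.
  exists a, (take n i).
  have : size (drop n i) = n.+1 by rewrite size_drop si addKn.
  case E: (drop n i) => [|b i2] // [s2]; exists b, i2.
  by rewrite -E cat_take_drop size_takel ?si ?leq_addr.
have E1 : take n.+1 (i1 ++ b :: i2) = rcons i1 b.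
  by rewrite -cat_rcons take_size_cat ?size_rcons ?s1.
have E2 : drop n.+1 (i1 ++ b :: i2) = i2.
  by rewrite -cat_rcons drop_size_cat ?size_rcons ?s1.
have E3 : rot n (rcons i1 b) = b :: i1 by rewrite -cats1 -s1 rot_size_cat.
rewrite /= ?drop0 ?take0 E1 E2 E3 /= ?drop0 ?take0.
rewrite (take_size_cat _ s1) (drop_size_cat _ s1).
rewrite /= ?drop0 ?take0 (take_size_cat _ s1) (drop_size_cat _ s1).
by rewrite eqseq_cons bvM !addn0.
Qed.

(* [psi] is prepared when the control wire carries [true], and the vacuum
   otherwise; fixing the second branch is what makes these states summable. *)
Definition controllable n (psi : seq bool -> C) : Prop :=
  realizable 1 n
    (fun o i => if head false i then psi o else bv (o == nseq n false)).

(** * Linear combinations of controllable states *)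

Lemma controllable_ext n psi phi :
  controllable n psi -> (forall o, size o = n -> phi o = psi o) ->
  controllable n phi.
Proof.
move=> cp E; apply: realizable_ext cp _ => o i so _.
by case: ifP => // _; apply: E.
Qed.

Lemma zip_addn0 n o s : size s = n ->
  (map nat_of_bool o ==
   [seq (p.1 + p.2)%N | p : bool * bool <- zip s (nseq n false)]) = (o == s).
Proof.
move=> <-; elim: s o => [|a s IHs] [|x o] //=.
by rewrite !eqseq_cons IHs addn0; case: x; case: a.
Qed.

Lemma zip_add0n n o s : size s = n ->
  (map nat_of_bool o ==
   [seq (p.1 + p.2)%N | p : bool * bool <- zip (nseq n false) s]) = (o == s).
Proof.
move=> <-; elim: s o => [|a s IHs] [|x o] //=.
by rewrite !eqseq_cons IHs add0n; case: x; case: a.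
Qed.

Lemma controllable_add n psi phi : controllable n psi -> controllable n phi ->
  controllable n (fun o => psi o + phi o).
Proof.
move=> cpsi cphi; have r := realizable_comp realizable_split
  (realizable_tens cpsi cphi).
apply: realizable_ext (realizable_comp r (realizable_merge_wires n)) _.
move=> o i so si; rewrite bsum_cat.
set vac := nseq n false; have svac : size vac = n by rewrite size_nseq.
(* After splitting, a control |1> leaves exactly one of the two blocks excited, while a control |0>
   leaves both in the vacuum. *)
transitivity (bsum n (fun s => bsum n (fun t =>
  bv (map nat_of_bool o == [seq (p.1 + p.2)%N | p : bool * bool <- zip s t]) *
  (if head false i then bv (s == vac) * phi t + bv (t == vac) * psi s
   else bv (s == vac) * bv (t == vac))))); last first.
  apply: eq_bsum => s ss; apply: eq_bsum => t st.
  rewrite !(take_size_cat _ ss) !(drop_size_cat _ ss).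
  by case: i si => [|[] []] //= _; rewrite -/vac; ring.
(* Merging with the vacuum on either side is the identity, so each branch collapses to one delta
   sum. *)
pose M s t := bv (map nat_of_bool o ==
  [seq (p.1 + p.2)%N | p : bool * bool <- zip s t]).
have M0 t : size t = n -> M vac t = bv (t == o).
  by move=> st; rewrite /M zip_add0n // eq_sym.
have M1 s : size s = n -> M s vac = bv (s == o).
  by move=> ss; rewrite /M zip_addn0 // eq_sym.
case: i si => [|[] []] //= _.
  transitivity (bsum n (fun s => bv (s == vac) * bsum n (fun t => M s t * phi t))
    + bsum n (fun s => bsum n (fun t => bv (t == vac) * (M s t * psi s)))).
    rewrite (bsum_delta (fun s => bsum n (fun t => M s t * phi t)) svac).
    rewrite addrC -(bsum_delta psi so) -(bsum_delta phi so).
    congr (_ + _); apply: eq_bsum => t st; first by rewrite M0.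
    by rewrite (bsum_delta (fun u => M t u * psi t) svac) M1.
  rewrite -bsumD; apply: eq_bsum => s ss; rewrite -bsumZ -bsumD.
  by apply: eq_bsum => t st; rewrite /M; ring.
transitivity (bsum n (fun s => bv (s == vac) *
    bsum n (fun t => bv (t == vac) * M s t))).
  rewrite (bsum_delta (fun s => bsum n (fun t => bv (t == vac) * M s t)) svac).
  by rewrite (bsum_delta (M vac) svac) M0 // eq_sym.
apply: eq_bsum => s ss; rewrite -bsumZ.
by apply: eq_bsum => t st; rewrite /M; ring.
Qed.

(** The scalar acts as diag(1, z) on the control wire; a global scalar would also rescale the vacuum
    branch. *)
Lemma controllable_scale n z psi :
  controllable n psi -> controllable n (fun o => z * psi o).
Proof.
move=> cpsi; apply: realizable_ext
  (realizable_precomp_weighted (f := id) _ (realizable_phase z) cpsi) _ => //.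
by move=> o [|[] []] //= _ _; rewrite mul1r.
Qed.

Lemma realizable_vacuum n : realizable 0 n (fun o _ => bv (o == nseq n false)).
Proof.
elim: n => [|n IHn].
  by apply: realizable_ext (realizable_id 0) _ => -[] // [].
apply: realizable_ext (realizable_tens (realizable_ket false) IHn) _.
by move=> [|a o] //= i _ _; rewrite drop0 take0 -bvM !eqseq_cons andbT.
Qed.

(** Testing the control against |0> kills the branch |1>, and the vacuum is prepared
    independently. *)
Lemma controllable0 n : controllable n (fun=> 0).
Proof.
apply: realizable_ext (realizable_tens (realizable_bra false)
  (realizable_vacuum n)) _.
by move=> o [|[] []] //= _ _; rewrite drop0 ?mul0r ?mul1r.
Qed.

Lemma controllable_bsum n k (F : seq bool -> seq bool -> C) :
  (forall s, size s = k -> controllable n (F s)) ->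
  controllable n (fun o => bsum k (fun s => F s o)).
Proof.
elim: k F => [|k IHk] F cF /=; first exact: cF.
by apply: controllable_add; apply: IHk => s sk; apply: cF; rewrite /= sk.
Qed.

(** * Controllability of odd states *)

Lemma parity_cons b s : parity (b :: s) = b (+) parity s.
Proof. by rewrite /parity /= oddD; case: b. Qed.

(* An even basis state cannot be controlled by one wire, so the induction
   carries its odd extension by one more particle. *)
Lemma controllable_basis s :
  if parity s then controllable (size s) (fun o => bv (o == s))
  else controllable (size s).+1 (fun o => bv (o == true :: s)).
Proof.
elim: s => [|[] s IHs].
- apply: realizable_ext (realizable_id 1) _.
  by case=> [|[] []] // [|[] []].
- rewrite parity_cons; case: (parity s) IHs => //= IHs.
  (* For odd [s], two copies of the control become the two leading ones and the third copy controls
     [s]. *)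
  apply: realizable_ext (realizable_comp realizable_copy
    (realizable_tens (realizable_id 2) IHs)) _.
  move=> [|x [|y o]] // [|[] []] //= _ _; rewrite !drop0 !take0 !eqseq_cons !bvM.
    by case: x; case: y => /=; ring.
  by case: x; case: y => /=; ring.
- rewrite parity_cons; case: (parity s) IHs => //= IHs.
    apply: realizable_ext (realizable_tens (realizable_ket false) IHs) _.
    move=> [|x o] // [|[] []] //= _ _; rewrite !drop0 !take0 !eqseq_cons !bvM.
      by case: x => /=; ring.
    by case: x => /=; ring.
  (* The new |0> lands in front of the extra particle; a swap puts the particle first again. *)
  have r := realizable_tens (realizable_ket false) IHs.
  have sw := realizable_tens realizable_swap (realizable_id (size s)).
  pose f (o : seq bool) := rev (take 2 o) ++ drop 2 o.
  apply: realizable_ext (realizable_postcomp (f := f) _ _ r) _.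
  + by move=> o so; rewrite size_cat size_rev -size_cat cat_take_drop.
  + apply: realizable_ext sw _ => -[|x [|y o]] // [|a [|b i]] // _ _.
    rewrite /f /= !drop0 !take0 /rev /= !eqseq_cons !bvM /=.
    by rewrite (eq_sym i); case: x; case: y; case: a; case: b => /=; ring.
  move=> [|x [|y o]] // [|[] []] //= _ _.
    by rewrite /f /= !drop0 !take0 /= !eqseq_cons !bvM; case: x; case: y => /=; ring.
  by rewrite /f /= !drop0 !take0 /= !eqseq_cons !bvM; case: x; case: y => /=; ring.
Qed.

Lemma controllable_odd n psi :
  (forall o, size o = n -> psi o != 0 -> parity o) -> controllable n psi.
Proof.
move=> odd_psi; apply: controllable_ext
  (_ : controllable n (fun o => bsum n (fun s => psi s * bv (o == s)))) _; last first.
  move=> o so; rewrite -(bsum_delta psi so).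
  by apply: eq_bsum => s _; rewrite mulrC eq_sym.
(* Even basis states occur only with coefficient 0, where the zero state takes their place. *)
apply: controllable_bsum => s ss; have [psi0|psi0] := eqVneq (psi s) 0.
  by apply: controllable_ext (controllable0 n) _ => o _; rewrite psi0 mul0r.
apply: controllable_scale.
by have := controllable_basis s; rewrite (odd_psi s) ?ss.
Qed.

(** * From states to pure maps *)

Lemma realizable_odd_state n psi :
  (forall o, size o = n -> psi o != 0 -> parity o) ->
  realizable 0 n (fun o _ => psi o).
Proof.
move=> /controllable_odd cpsi.
apply: realizable_ext (realizable_comp realizable_ket1 cpsi) _.
by move=> o i _ _ /=; ring.
Qed.

Lemma realizable_even_state n psi :
  (forall o, size o = n -> psi o != 0 -> ~~ parity o) ->
  realizable 0 n (fun o _ => psi o).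
Proof.
(* Without a wire to flip, the state is the scalar [psi [::]]. *)
case: n => [_|n even_psi].
  apply: realizable_ext (realizable_scale (psi [::]) (realizable_id 0)) _.
  by move=> [] // [] //= _ _; rewrite mulr1.
pose f o := ~~ head false o :: behead o.
have rf : realizable n.+1 n.+1 (fun o i => bv (i == f o)).
  apply: realizable_ext (realizable_tens realizable_flip (realizable_id n)) _.
  move=> [|x o] // [|a i] //= _ _; rewrite !drop0 !take0 !eqseq_cons bvM eq_sym.
  by rewrite (eq_sym i); case: x; case: a.
have ro : realizable 0 n.+1 (fun o _ => psi (f o)).
  apply: realizable_odd_state => -[|x o] // so psi_o.
  have := even_psi (f (x :: o)) so psi_o.
  by rewrite !parity_cons; case: x {so psi_o}; case: (parity o).
apply: realizable_ext (realizable_postcomp _ rf ro) _; first by case.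
by case=> [|x o] // i _ _; rewrite /f /= negbK.
Qed.

(** One bit [b] treats even and odd maps together. It is the total parity of inputs and outputs, so
    it survives moving an input to the output side, and induction on [n] reduces to states. *)
Lemma realizable_pure n m b (g : lmap) :
  (forall o i, size o = m -> size i = n -> g o i != 0 ->
     parity o (+) parity i = b) -> realizable n m g.
Proof.
elim: n m g => [|n IHn] m g pg.
  have r : realizable 0 m (fun o _ => g o [::]).
    case: b pg => pg; [apply: realizable_odd_state | apply: realizable_even_state].
      by move=> o so /pg -/(_ so erefl); rewrite addbF.
    by move=> o so /pg -/(_ so erefl); rewrite addbF => ->.
  by apply: realizable_ext r _ => o [].
have r : realizable n m.+1 (fun o i => g (behead o) (head false o :: i)).
  apply: IHn => -[|x o] // i [so] si /pg.
  by rewrite /= si => /(_ so erefl); rewrite !parity_cons => <-;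
  rewrite addbCA addbA.
by apply: realizable_ext (realizable_bend r) _ => o [].
Qed.

End Realizable.

Theorem theorem4p1 (R : realType) (n m : nat) (g : lmap R) :
  pure_map n m g ->
  exists d : diag R n m,
    forall (o : m.-tuple bool) (i : n.-tuple bool), g o i = interp d o i.
Proof.
move=> pg.
have [b pgb] : exists b, forall o i, size o = m -> size i = n -> g o i != 0 ->
    parity o (+) parity i = b.
  case: pg => pg; [exists false | exists true] => o i so si.
    move/eqP: so => so; move/eqP: si => si /(pg (Tuple so) (Tuple si)) /= ->.
    exact: addbb.
  move/eqP: so => so; move/eqP: si => si /(pg (Tuple so) (Tuple si)) /=.
  by case: parity; case: parity.
have [d Hd] := realizable_pure pgb.
by exists d => o i; apply: Hd; rewrite size_tuple.
Qed.
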